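(* Let $H_1$ and $H_2$ be real Hilbert spaces, let $A:H_1\rightarrow H_2$ be a bounded linear operator, and let $C\subseteq H_1$ and $Q\subseteq H_2$ be nonempty, closed and convex subsets. Let $f:H_1\rightarrow H_1$ and $g:H_2\rightarrow H_2$ be $\alpha_1$-ISM and $\alpha_2$-ISM operators on $H_1$ and $H_2$, respectively, and set $\alpha:=\min\{\alpha_1,\alpha_2\}$. Let $L$ be the spectral radius of the operator $A^{\ast}A$, where $A^{\ast}$ is the adjoint of $A$, and assume that $\gamma\in(0,1/L)$. Consider the operators $U=P_C(I-\lambda f)$ and $T=P_Q(I-\lambda g)$ with $\lambda\in(0,2\alpha]$. Let $$\Gamma:=\{z\in SOL(C,f)\mid Az\in SOL(Q,g)\}.$$ Assume further that $\Gamma\neq\emptyset$ and that, for all $x^{\ast}\in SOL(C,f)$, $$\langle f(x),P_C(I-\lambda f)(x)-x^{\ast}\rangle\geq 0\quad\text{for all }x\in H_1.$$ Then any sequence $\{x^k\}_{k=0}^{\infty}$ generated from an arbitrary starting point $x^0\in H_1$ by $$x^{k+1}=U\left(x^{k}+\gamma A^{\ast}(T-I)(Ax^{k})\right),\quad k\geq 0,$$ converges weakly to a point $x^{\ast}\in\Gamma$.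
   Context: For a nonempty, closed and convex subset $D$ of a real Hilbert space $H$, $P_D$ denotes the metric (nearest point) projection of $H$ onto $D$, and $I$ the identity operator; $P_D(I-\lambda h)(x)=P_D(x-\lambda h(x))$. $SOL(D,h)=\{x^{\ast}\in D\mid\langle h(x^{\ast}),x-x^{\ast}\rangle\geq 0\text{ for all }x\in D\}$. An operator $h:H\to H$ is called $\alpha$-ISM (inverse strongly monotone with constant $\alpha>0$) on $D\subseteq H$ if $\langle h(x)-h(y),x-y\rangle\geq\alpha\Vert h(x)-h(y)\Vert^2$ for all $x,y\in D$. *)

(* Defs.v *)
From HB Require Import structures.
From mathcomp Require Import all_boot all_order all_algebra.
From mathcomp Require Import sesquilinear complex.
From mathcomp Require Import all_classical all_reals all_analysis.

Set Implicit Arguments.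
Unset Strict Implicit.
Unset Printing Implicit Defensive.

Import Order.TTheory GRing.Theory Num.Theory.
Import numFieldNormedType.Exports.

Local Open Scope classical_set_scope.
Local Open Scope ring_scope.

HB.mixin Record isHilbert (R : realType) H of CompleteNormedModule R H := {
  inner : {dot H for idfun};
  inner_norm : forall x : H, inner x x = `|x| ^+ 2
}.

#[short(type=hilbertType)]
HB.structure Definition Hilbert (R : realType) :=
  {H of isHilbert R H & CompleteNormedModule R H}.

Section Operators.
Variables (R : realType) (H : hilbertType R).

(* For nonempty closed convex [D] the nearest point exists and is unique, so
   the default value [0] is never used. *)
Definition proj (D : set H) (x : H) : H :=
  xget 0 [set p | D p /\ forall y, D y -> `|x - p| <= `|x - y|].

Definition proj_grad (D : set H) (lambda : R) (h : H -> H) (x : H) : H :=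
  proj D (x - lambda *: h x).

Definition SOL (D : set H) (h : H -> H) : set H :=
  [set z | D z /\ forall x, D x -> 0 <= inner (h z) (x - z)].

Definition ISM (alpha : R) (D : set H) (h : H -> H) : Prop :=
  0 < alpha /\
  forall x y, D x -> D y ->
    alpha * `|h x - h y| ^+ 2 <= inner (h x - h y) (x - y).

Definition weakly_converges (x : nat -> H) (l : H) : Prop :=
  forall phi : {linear H -> R^o}, continuous phi ->
    phi (x k) @[k --> \oo] --> phi l.

End Operators.

(* For bounded linear [A] the representing vector exists and is unique (Riesz),
   so the default value [0] is never used. *)
Definition adjoint (R : realType) (H1 H2 : hilbertType R) (A : H1 -> H2)
    (y : H2) : H1 :=
  xget 0 [set z | forall x, inner (A x) y = inner x z].

Definition bounded_linear (R : realType) (V W : normedModType R)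
    (A : {linear V -> W}) : Prop :=
  exists M : R, forall x, `|A x| <= M * `|x|.

Definition bounded_invertible (R : realType) (V : normedModType R)
    (S : V -> V) : Prop :=
  exists T : {linear V -> V}, [/\ bounded_linear T, cancel S T & cancel T S].

(* The spectrum of an operator on a real space is that of its complexification;
   [u + i v] is encoded by the pair [(u, v)], so this is
   [z (u + i v) - (B u + i B v)]. The max norm of [H * H] is equivalent to the
   Hilbert norm of the complexification, so boundedness is unaffected. *)
Definition complexified_resolvent_op (R : realType) (H : normedModType R)
    (B : H -> H) (z : R[i]) (w : (H * H)%type) : (H * H)%type :=
  (complex.Re z *: w.1 - complex.Im z *: w.2 - B w.1,
   complex.Re z *: w.2 + complex.Im z *: w.1 - B w.2).

Definition spectrum (R : realType) (H : normedModType R) (B : H -> H)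
    : set R[i] :=
  [set z | ~ bounded_invertible (complexified_resolvent_op B z)].

(* [maxe 0] only matters on the zero space, where the spectrum is empty and
   the supremum would be [-oo]. *)
Definition spectral_radius (R : realType) (H : normedModType R) (B : H -> H)
    : \bar R :=
  maxe 0%E (ereal_sup [set (Normc.normc z)%:E | z in spectrum B]).

(* Main.v *)
(** Fix a solution z in Gamma. The fixed points of U and T are the solutions of
    the two variational inequalities, both maps are nonexpansive, and the sign
    hypothesis on f makes U a cutter with respect to z. With M = sup |Ax|^2 over
    the unit ball, nonexpansiveness of T gives
      |w_k - z|^2 <= |x_k - z|^2 - gamma (1 - gamma M) |T A x_k - A x_k|^2
    for w_k = x_k + gamma A^*(T - I) A x_k, and the cutter property gives
      |U w_k - z|^2 <= |w_k - z|^2 - |U w_k - w_k|^2.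
    So x_k is Fejer monotone and both residuals tend to 0. Here gamma M < 1
    because M <= L: M - A^*A is positive but not bounded below, hence M lies in
    the spectrum of A^*A.

    Weak limits are taken along ultrafilters on nat: a bounded sequence always
    has one, by the Riesz representation of h |-> lim <x_k, h>, which avoids
    weak sequential compactness in nonseparable spaces. By demiclosedness each
    such limit belongs to Gamma, and by Opial's argument they all coincide. *)
From HB Require Import structures.
Require Import Defs.
From mathcomp Require Import all_boot all_order all_algebra.
From mathcomp Require Import sesquilinear complex ring lra.
From mathcomp Require Import all_classical all_reals all_analysis.

Import Order.TTheory GRing.Theory Num.Theory.
Import numFieldNormedType.Exports.

Local Open Scope classical_set_scope.
Local Open Scope ring_scope.

(** * Inner product identities and the Cauchy-Schwarz inequality *)

Section InnerProduct.
Context {R : realType} {H : hilbertType R}.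
Implicit Types (x y z : H) (a : R).

Lemma innerC x y : inner x y = inner y x.
Proof. by rewrite hermC expr0 mul1r. Qed.

Lemma innerDl x y z : inner (x + y) z = inner x z + inner y z.
Proof. exact: linearDl. Qed.

Lemma innerZl a x z : inner (a *: x) z = a * inner x z.
Proof. exact: linearZl_LR. Qed.

Lemma innerNl x z : inner (- x) z = - inner x z.
Proof. exact: linearNl. Qed.

Lemma innerDr x y z : inner z (x + y) = inner z x + inner z y.
Proof. by rewrite innerC innerDl !(innerC z). Qed.

Lemma innerZr a x z : inner z (a *: x) = a * inner z x.
Proof. by rewrite innerC innerZl innerC. Qed.

Lemma innerNr x z : inner z (- x) = - inner z x.
Proof. by rewrite innerC innerNl innerC. Qed.

Lemma inner0l z : inner 0 z = 0.
Proof. by rewrite -(scale0r z) innerZl mul0r. Qed.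

Definition innerE := (innerDl, innerDr, innerNl, innerNr, innerZl, innerZr).

Lemma inner_ge0 x : 0 <= inner x x.
Proof. by rewrite inner_norm sqr_ge0. Qed.

Lemma inner_eq0 x : inner x x = 0 -> x = 0.
Proof. by rewrite inner_norm => /eqP; rewrite sqrf_eq0 normr_eq0 => /eqP. Qed.

(** Testing against an arbitrary vector turns vector identities into scalar ones, which [ring] and
    [field] can close. *)
Lemma inner_inj x y : (forall z, inner x z = inner y z) -> x = y.
Proof.
move=> xy; apply/eqP; rewrite -subr_eq0; apply/eqP/inner_eq0.
by rewrite innerDl innerNl xy subrr.
Qed.

Lemma ler_norm_inner x y : (`|x| <= `|y|) = (inner x x <= inner y y).
Proof. by rewrite !inner_norm ler_pXn2r// nnegrE. Qed.

Lemma cauchy_schwarz x y : `|inner x y| <= `|x| * `|y|.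
Proof.
have [->|y0] := eqVneq y 0; first by rewrite innerC inner0l !normr0 mulr0.
rewrite -(@ler_pXn2r _ 2)// ?nnegrE ?mulr_ge0//.
rewrite exprMn -!inner_norm real_normK ?num_real//.
have ny : 0 < inner y y by rewrite inner_norm exprn_gt0// normr_gt0.
(* This multiple of the component of x orthogonal to y needs no division; its squared norm is |y|^2
   (|x|^2 |y|^2 - <x,y>^2). *)
have := inner_ge0 (inner y y *: x - inner x y *: y).
rewrite !innerE (innerC y x) => h.
rewrite -subr_ge0 -(pmulr_rge0 _ ny); lra.
Qed.

Lemma normD_sq x y : `|x + y| ^+ 2 = `|x| ^+ 2 + 2 * inner x y + `|y| ^+ 2.
Proof. by rewrite -!inner_norm !innerE (innerC y x); ring. Qed.

Lemma normB_sq x y : `|x - y| ^+ 2 = `|x| ^+ 2 - 2 * inner x y + `|y| ^+ 2.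
Proof. by rewrite normD_sq normrN innerNr; ring. Qed.

End InnerProduct.

(** * Metric projections and projected gradient maps *)

Section Projection.
Context {R : realType} {H : hilbertType R}.
Implicit Types (D : set H) (x y p : H).

Lemma convex_segment D x y (t : R) : convex_set D -> D x -> D y ->
  0 <= t <= 1 -> D (x + t *: (y - x)).
Proof.
move=> cD Dx Dy /andP[t0 t1].
have := cD y x (Itv01 t0 t1); rewrite !inE => /(_ Dy Dx).
by congr (D _); rewrite /conv/= scalerBr scalerBl scale1r addrCA.
Qed.


(** Parallelogram law: the midpoint of two terms lies in D, so its squared distance to x is at least
    d, which gives |y_N - y_n|^2 <= 2 (1/(N+1) + 1/(n+1)). The sequence is therefore Cauchy. *)
Lemma minimizing_sequence_cvg D x (d : R) (y : nat -> H) : convex_set D ->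
  (forall z, D z -> d <= `|x - z| ^+ 2) ->
  (forall n, D (y n)) ->
  (forall n, `|x - y n| ^+ 2 <= d + n.+1%:R^-1) -> cvgn y.
Proof.
move=> cD dD Dy dy; apply: cauchy_cvg; apply: cauchy_exP => e e0.
have e4 : 0 < e ^+ 2 / 4 by rewrite divr_gt0 ?exprn_gt0.
have [N _ hN] := near_infty_natSinv_lt (PosNum e4).
exists (y N), N => // n /= Nn.
rewrite -ball_normE /= -(@ltr_pXn2r _ 2)// ?nnegrE ?(ltW e0)//.
have := dD _ (convex_segment _ _ _ 2^-1 cD (Dy N) (Dy n) _).
have := dy N; have := dy n.
have half : 0 <= (2^-1 : R) <= 1 by lra.
have := hN n Nn; have := hN N (leqnn N).
rewrite /= => eN en yn yN /(_ half).
have -> : x - (y N + 2^-1 *: (y n - y N)) = 2^-1 *: ((x - y N) + (x - y n)).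
  by apply: inner_inj => w; rewrite !innerE; field.
have -> : y N - y n = (x - y n) - (x - y N).
  by apply: inner_inj => w; rewrite !innerE; ring.
rewrite -[`|2^-1 *: _| ^+ 2]inner_norm innerZl innerZr inner_norm.
rewrite (normB_sq (x - y n)) (normD_sq (x - y N) (x - y n)) (innerC (x - y n)).
move: (N.+1%:R^-1) (n.+1%:R^-1) eN en yN yn => eN en; lra.
Qed.

Lemma proj_exists D x : D !=set0 -> closed D -> convex_set D ->
  exists p, D p /\ forall z, D z -> `|x - p| <= `|x - z|.
Proof.
move=> [z0 Dz0] clD cD; pose E := [set `|x - z| ^+ 2 | z in D].
have lbE : lbound E 0 by move=> _ [z _ <-]; exact: sqr_ge0.
have infE : has_inf E by split; [exists (`|x - z0| ^+ 2), z0|exists 0].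
have dD z : D z -> inf E <= `|x - z| ^+ 2.
  by move=> Dz; apply: ge_inf; [case: infE|exists z].
have /choice[y hy] : forall n, exists z, D z /\ `|x - z| ^+ 2 <= inf E + n.+1%:R^-1.
  move=> n; have n0 : 0 < n.+1%:R^-1 :> R by rewrite invr_gt0.
  by have [_ [z Dz <-] /ltW zE] := inf_adherent n0 infE; exists z.
have Dy n : D (y n) by case: (hy n).
have := minimizing_sequence_cvg _ _ _ _ cD dD Dy (fun n => (hy n).2).
set p := lim _ => yp; exists p; split.
  by apply: (closed_cvg _ clD _ _ yp); exact: nearW.
move=> z Dz; rewrite -(@ler_pXn2r _ 2)// ?nnegrE//.
apply: le_trans (dD _ Dz); apply/ler_addgt0Pr => e e0.
have lim2 : `|x - y n| ^+ 2 @[n --> \oo] --> `|x - p| ^+ 2.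
  by apply: cvgM; apply: cvg_norm; apply: cvgB => //; exact: cvg_cst.
apply: (ler_cvg_to lim2 (cvg_cst _)).
near=> n; apply: le_trans (hy n).2 _; rewrite lerD2l ltW//.
by near: n; exact: (near_infty_natSinv_lt (PosNum e0)).
Unshelve. all: by end_near. Qed.

(** First-order optimality: if the inner product s were positive, a short move from p towards y
    would come closer to x. *)
Lemma projP D x : D !=set0 -> closed D -> convex_set D ->
  D (Defs.proj D x) /\ forall y, D y -> inner (x - Defs.proj D x) (y - Defs.proj D x) <= 0.
Proof.
move=> D0 clD cD; have := xgetPex 0 (proj_exists D x D0 clD cD).
rewrite -/(Defs.proj D x); move: (Defs.proj D x) => p [Dp px].
split=> // y Dy; rewrite leNgt; apply/negP => s0.
set s := inner _ _ in s0; set n := inner (y - p) (y - p).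
have n0 : 0 <= n by exact: inner_ge0.
have sn0 : 0 < s + n by rewrite ltr_pwDl.
(* Minimality against p + t (y - p) gives 2 s <= t n, whereas this t satisfies t n = s - t s < s.
   Adding s to the denominator keeps t in (0,1] and covers n = 0. *)
set t := s / (s + n).
have t0 : 0 < t by rewrite divr_gt0.
have t1 : t <= 1 by rewrite ler_pdivrMr// mul1r lerDl.
have tn : t * (s + n) = s by rewrite divfK// gt_eqF.
have t01 : 0 <= t <= 1 by rewrite t1 ltW.
have := px _ (convex_segment _ _ _ t cD Dp Dy t01).
rewrite opprD addrA -(@ler_pXn2r _ 2)// ?nnegrE// (normB_sq (x - p) (t *: _)) innerZr -/s.
rewrite -[`|t *: _| ^+ 2]inner_norm innerZl innerZr -/n => h.
have : t * (2 * s) <= t * (t * n) by lra.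
rewrite ler_pM2l//.
by nra.
Qed.

Lemma proj_unique D x p : D !=set0 -> closed D -> convex_set D ->
  D p -> (forall y, D y -> inner (x - p) (y - p) <= 0) -> Defs.proj D x = p.
Proof.
move=> D0 clD cD Dp hp; have [Dq hq] := projP D x D0 clD cD.
apply/eqP; rewrite -subr_eq0; apply/eqP/inner_eq0/eqP; rewrite eq_le inner_ge0 andbT.
have := hp _ Dq; have := hq _ Dp; set q := Defs.proj D x.
rewrite !innerE (innerC q p); lra.
Qed.

(** Adding the variational inequalities of p and q gives |p - q|^2 <= <x - y, p - q>; expanding |(x
    - y) - (p - q)|^2 >= 0 then finishes. *)
Lemma proj_nonexpansive D x y : D !=set0 -> closed D -> convex_set D ->
  `|Defs.proj D x - Defs.proj D y| <= `|x - y|.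
Proof.
move=> D0 clD cD.
have [Dx hx] := projP D x D0 clD cD; have [Dy hy] := projP D y D0 clD cD.
rewrite ler_norm_inner.
have := hx _ Dy; have := hy _ Dx; have := inner_ge0 ((x - y) - (Defs.proj D x - Defs.proj D y)).
set p := Defs.proj D x; set q := Defs.proj D y.
rewrite !innerE (innerC q p) (innerC q x) (innerC q y) (innerC p x) (innerC p y).
rewrite (innerC y x); lra.
Qed.

(** At the point z - lambda h(z), the variational inequality for the projection z reads <- lambda
    h(z), y - z> <= 0, which is the condition in [SOL] up to the factor lambda > 0. *)
Lemma SOL_fixed D h (lambda : R) z : D !=set0 -> closed D -> convex_set D ->
  0 < lambda -> SOL D h z <-> proj_grad D lambda h z = z.
Proof.
move=> D0 clD cD l0; rewrite /SOL /proj_grad /=; split=> [[Dz hz]|fixz].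
  apply: proj_unique => // y /hz; rewrite addrAC subrr add0r innerNl innerZl.
  by rewrite oppr_le0 pmulr_rge0.
have [] := projP D (z - lambda *: h z) D0 clD cD.
rewrite fixz => Dz hz; split=> // y /hz.
by rewrite addrAC subrr add0r innerNl innerZl oppr_le0 pmulr_rge0.
Qed.

(** Testing the projection p of x - lambda h(x) against z and using the sign assumption gives <x -
    p, z - p> <= 0: the angle at p is not acute. *)
Lemma proj_grad_cutter D h (lambda : R) x z :
  D !=set0 -> closed D -> convex_set D -> 0 <= lambda -> D z ->
  0 <= inner (h x) (proj_grad D lambda h x - z) ->
  `|proj_grad D lambda h x - z| ^+ 2 <=
    `|x - z| ^+ 2 - `|proj_grad D lambda h x - x| ^+ 2.
Proof.
rewrite /proj_grad => D0 clD cD l0 Dz.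
have [_ /(_ z Dz)] := projP D (x - lambda *: h x) D0 clD cD.
set p := Defs.proj _ _ => hp /(mulr_ge0 l0) hl.
move: hp hl; rewrite -!inner_norm !innerE (innerC z p) (innerC z x) (innerC p x).
lra.
Qed.

(** Already I - lambda h is nonexpansive: in the expanded square, lambda |hx - hy|^2 <= 2 alpha |hx
    - hy|^2 <= 2 <hx - hy, x - y>. *)
Lemma proj_grad_nonexpansive D h (alpha lambda : R) x y :
  D !=set0 -> closed D -> convex_set D -> ISM alpha setT h ->
  0 <= lambda <= 2 * alpha ->
  `|proj_grad D lambda h x - proj_grad D lambda h y| <= `|x - y|.
Proof.
move=> D0 clD cD [a0 hI] /andP[l0 la].
apply: le_trans (proj_nonexpansive D _ _ D0 clD cD) _.
have -> : x - lambda *: h x - (y - lambda *: h y) =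
  x - y - lambda *: (h x - h y) by apply: inner_inj => w; rewrite !innerE; ring.
rewrite -(@ler_pXn2r _ 2)// ?nnegrE// (normB_sq (x - y)).
rewrite -[`|lambda *: _| ^+ 2]inner_norm innerZl !innerZr inner_norm.
have := hI x y I I; rewrite innerC; move: (inner _ _) => s.
have : 0 <= `|h x - h y| ^+ 2 by exact: sqr_ge0.
move: (`|h x - h y| ^+ 2) => n n0 hs.
have h1 : lambda * n <= 2 * s by nra.
have := ler_wpM2l l0 h1; lra.
Qed.

Lemma nonexpansive_fixed_inner (T : H -> H) q y :
  (forall x y, `|T x - T y| <= `|x - y|) -> T q = q ->
  2 * inner (y - q) (T y - y) <= - `|T y - y| ^+ 2.
Proof.
move=> Tn Tq; have := Tn y q; rewrite Tq ler_norm_inner -inner_norm.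
by rewrite !innerE (innerC q y) (innerC q (T y)) (innerC y (T y)); lra.
Qed.

End Projection.

(** * Riesz representation *)

Section Riesz.
Context {R : realType} {H : hilbertType R}.

(** For phi nonzero, the point p of the hyperplane phi = 1 nearest to 0 is orthogonal to the kernel,
    and p / |p|^2 represents phi. *)
Lemma riesz (phi : {linear H -> R^o}) : continuous phi ->
  exists h : H, forall x, phi x = inner h x.
Proof.
move=> cphi.
have [phi0|/existsNP[x0 /eqP x00]] := pselect (forall x, phi x = 0).
  by exists 0 => x; rewrite phi0 inner0l.
pose D : set H := phi @^-1` [set 1].
have D0 : D !=set0.
  by exists ((phi x0)^-1 *: x0); rewrite /D /= linearZ /= [_ *: _]mulVf.
have clD : closed D by apply: closed_comp => // x _; exact: cphi.
have cD : convex_set D.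
  move=> x y t; rewrite !inE /D /= => Dx Dy.
  by rewrite /conv/= linearD !linearZ Dx Dy -scalerDl addrC subrK scale1r.
have [] := projP D 0 D0 clD cD; set p := Defs.proj D 0 => Dp hp.
have kerp v : phi v = 0 -> inner p v = 0.
  (* Both p + v and p - v stay in the hyperplane, so the inequality holds with either sign. *)
  move=> v0; have := hp (p + v); have := hp (p - v).
  rewrite /D /= (linearB phi) (linearD phi) v0 Dp subr0 addr0 => /(_ erefl) h1 /(_ erefl).
  move: h1; rewrite !innerE !inner0l; lra.
have np : inner p p != 0.
  apply/eqP => /inner_eq0 p0; have := Dp; rewrite /D /= p0 linear0 => /eqP.
  by rewrite eq_sym oner_eq0.
exists ((inner p p)^-1 *: p) => x; rewrite innerZl.
have := kerp (x - phi x *: p).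
rewrite (linearB phi) linearZ /= Dp [_ *: _]mulr1 subrr => /(_ erefl).
by rewrite !innerE => /eqP; rewrite subr_eq0 => /eqP ->; rewrite mulrCA mulVf// mulr1.
Qed.

Lemma riesz_bounded (phi : H -> R) (M : R) :
  (forall a x y, phi (a *: x + y) = a * phi x + phi y) ->
  (forall x, `|phi x| <= M * `|x|) ->
  exists h : H, forall x, phi x = inner h x.
Proof.
move=> lphi bphi.
pose m := GRing.isLinear.Build R H R^o *:%R phi lphi.
pose F : {linear H -> R^o} := HB.pack phi m.
apply: (riesz F); apply: bounded_linear_continuous; apply/linear_boundedP.
near=> r => x; apply: le_trans (bphi x) _; rewrite ler_wpM2r//.
Unshelve. all: by end_near. Qed.

End Riesz.

(** * Adjoints and limits along ultrafilters *)

Section Adjoint.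
Context {R : realType} {H1 H2 : hilbertType R}.
Variables (A : {linear H1 -> H2}).
Hypothesis A_bounded : bounded_linear A.

Lemma adjointE x y : inner (A x) y = inner x (adjoint A y).
Proof.
have [M hM] := A_bounded.
suff [h hh] : exists h, forall x, inner (A x) y = inner h x.
  have ex : exists z, forall x, inner (A x) y = inner x z.
    by exists h => z; rewrite hh innerC.
  exact: (xgetPex 0 ex x).
apply: (riesz_bounded _ (M * `|y|)) => [a u v|u].
  by rewrite linearP innerDl innerZl.
apply: le_trans (cauchy_schwarz _ _) _.
by rewrite mulrAC ler_wpM2r.
Qed.

End Adjoint.

(** Compactness of [-M, M] yields a cluster point, and a cluster point of an ultrafilter is a
    limit. *)
Lemma ultrafilter_bounded_cvg {R : realType} {T : Type} (F : set_system T)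
    (u : T -> R) (M : R) : UltraFilter F -> (forall k, `|u k| <= M) ->
  exists l : R, u k @[k --> F] --> l.
Proof.
move=> FU uM; have FP : ProperFilter F by exact: ultra_proper.
have uF : (u @ F) [set` `[- M, M]].
  by apply: nearW => k; rewrite /= in_itv/= -ler_norml.
have [l [_ cl]] := segment_compact _ uF.
exists l => B Bl; have [//|FnB] := in_ultra_setVsetC (u @^-1` B) FU.
by have [x []] := cl (~` B) B FnB Bl.
Qed.

(** * The squared operator norm of A and the spectral radius of A^* A *)

Section SpectralRadius.
Context {R : realType} {H1 H2 : hilbertType R}.
Variables (A : {linear H1 -> H2}).
Hypothesis A_bounded : bounded_linear A.

Lemma sup_norm_sq : exists M : R, [/\ 0 <= M,
  forall x, `|A x| ^+ 2 <= M * `|x| ^+ 2 &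
  forall e, 0 < e -> exists x, `|x| <= 1 /\ M - e < `|A x| ^+ 2].
Proof.
have [K hK] := A_bounded.
pose E := [set `|A x| ^+ 2 | x in [set x | `|x| <= 1]].
have E0 : E 0 by exists 0; rewrite /= ?linear0 ?normr0 ?expr0n.
have supE : has_sup E.
  split; first by exists 0.
  (* [K] may be negative when the space is trivial, hence the absolute value. *)
  exists (`|K| ^+ 2) => _ [x /= x1 <-].
  rewrite ler_pXn2r// ?nnegrE//; apply: le_trans (hK x) _.
  apply: le_trans (ler_wpM2r (normr_ge0 x) (ler_norm K)) _.
  by rewrite ler_piMr.
exists (sup E); split.
- by apply: ub_le_sup => //; case: supE.
- move=> x; have [->|x0] := eqVneq x 0.
    by rewrite linear0 !normr0 expr0n mulr0.
  have nx : 0 < `|x| by rewrite normr_gt0.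
  have /(ub_le_sup supE.2) : E (`|A (`|x|^-1 *: x)| ^+ 2).
    exists (`|x|^-1 *: x) => //=.
    by rewrite normrZ normfV normr_id mulVf// gt_eqF.
  rewrite linearZ normrZ normfV normr_id exprMn exprVn.
  by rewrite mulrC ler_pdivrMr// exprn_gt0.
- move=> e e0; have [_ [x x1 <-] xe] := sup_adherent e0 supE.
  by exists x.
Qed.

(* Positivity of [M - A^* A] at [x - M^-1 p], where [p = (M - A^* A) x]. *)
Lemma defect_norm_sq (M : R) x : 0 < M ->
  (forall x, `|A x| ^+ 2 <= M * `|x| ^+ 2) ->
  `|M *: x - adjoint A (A x)| ^+ 2 <= M * (M * `|x| ^+ 2 - `|A x| ^+ 2).
Proof.
move=> M0 hM; set p := M *: x - adjoint A (A x).
have pp : `|p| ^+ 2 = M * inner x p - inner (A x) (A p).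
  rewrite -inner_norm {1}/p innerDl innerZl innerNl.
  by rewrite (innerC (adjoint A (A x))) -adjointE// (innerC (A p)).
have := hM (x - M^-1 *: p); rewrite linearB linearZ /=.
rewrite (normB_sq (A x)) (normB_sq x) !innerZr.
rewrite -[`|M^-1 *: A p| ^+ 2]inner_norm -[`|M^-1 *: p| ^+ 2]inner_norm.
rewrite !innerZl !innerZr !inner_norm.
set t := M^-1; have tM : t * M = 1 by rewrite mulVf// gt_eqF.
have Ap0 : 0 <= t * (t * `|A p| ^+ 2) by rewrite !mulr_ge0// ?invr_ge0 ?ltW.
move=> h; rewrite -(@ler_pM2l _ t) ?invr_gt0// [leRHS]mulrA tM mul1r.
have : t * (t * (M * `|p| ^+ 2)) = t * `|p| ^+ 2 by rewrite (mulrA t M) tM mul1r.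
have : t * `|p| ^+ 2 = M * (t * inner x p) - t * inner (A x) (A p).
  by rewrite pp; ring.
lra.
Qed.

(** A bounded inverse of M - A^* A with constant K would give |x|^2 <= K^2 M (M |x|^2 - |Ax|^2). For
    near-maximizers of |Ax|^2 the right side is tiny, although |x|^2 must be close to 1. *)
Lemma sup_norm_sq_spectrum (M : R) : 0 < M ->
  (forall x, `|A x| ^+ 2 <= M * `|x| ^+ 2) ->
  (forall e, 0 < e -> exists x, `|x| <= 1 /\ M - e < `|A x| ^+ 2) ->
  spectrum (adjoint A \o A) (real_complex R M).
Proof.
move=> M0 hM supM; rewrite /spectrum /= => -[S [[K hK] ST _]].
have hx x : `|x| ^+ 2 <= K ^+ 2 * `|M *: x - adjoint A (A x)| ^+ 2.
  (* The inverse is tested on real vectors (x, 0); this makes the imaginary component of the image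
     vanish. *)
  have B0 : adjoint A (A 0) = 0.
    by apply: inner_inj => z; rewrite innerC -adjointE// linear0 innerC !inner0l.
  have := hK (complexified_resolvent_op (adjoint A \o A) (real_complex R M) (x, 0)).
  rewrite ST /complexified_resolvent_op /= B0 !scale0r !scaler0 !subr0 addr0.
  rewrite !prod_normE /= normr0 !max_l// => xK.
  have le0 := le_trans (normr_ge0 x) xK.
  by rewrite -exprMn ler_pXn2r// ?nnegrE.
(* With e = M / c, the estimates give M - e < |Ax|^2 <= M |x|^2 <= M K^2 M e, that is M < c e =
   M. *)
pose c := 1 + M * (K ^+ 2 * M).
have c0 : 0 < c by rewrite ltr_pwDl// mulr_ge0 ?(ltW M0)// mulr_ge0 ?sqr_ge0 ?(ltW M0).
have [x [x1 hxe]] := supM (M / c) (divr_gt0 M0 c0).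
have nx1 : `|x| ^+ 2 <= 1 by rewrite expr_le1.
have ec : M / c * c = M by rewrite divfK// gt_eqF.
have h1 := defect_norm_sq M x M0 hM.
have h2 : M * `|x| ^+ 2 - `|A x| ^+ 2 <= M / c.
  by have := ler_wpM2l (ltW M0) nx1; lra.
have h3 : `|x| ^+ 2 <= K ^+ 2 * (M * (M / c)).
  apply: le_trans (hx x) _; apply: ler_wpM2l; first exact: sqr_ge0.
  by apply: le_trans h1 _; rewrite ler_pM2l.
have := ler_wpM2l (ltW M0) h3; have := hM x; move: hxe ec; rewrite /c.
move: (M / _) => e; lra.
Qed.

Lemma norm_sq_spectral_radius (gamma : R) : 0 < gamma ->
  (gamma%:E < (spectral_radius (adjoint A \o A))^-1)%E ->
  exists M, [/\ 0 <= M, gamma * M < 1 & forall x, `|A x| ^+ 2 <= M * `|x| ^+ 2].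
Proof.
move=> g0 gL; have [M [M0 hM supM]] := sup_norm_sq; exists M; split=> //.
move: M0; rewrite le_eqVlt => /predU1P[<-|M0]; first by rewrite mulr0.
have : (M%:E <= spectral_radius (adjoint A \o A))%E.
  rewrite /spectral_radius le_max; apply/orP; right.
  apply: ereal_sup_ubound; exists (real_complex R M).
    exact: sup_norm_sq_spectrum.
  by rewrite /= expr0n addr0 sqrtr_sqr gtr0_norm.
(* An infinite radius has inverse 0, contradicting 0 < gamma. *)
move: gL; case: (spectral_radius _) => [r||] //=; last first.
  by rewrite invey lte_fin => /(lt_trans g0); rewrite ltxx.
rewrite lee_fin => gr Mr; have r0 := lt_le_trans M0 Mr.
move: gr; rewrite inver gt_eqF// lte_fin => gr.
apply: (@le_lt_trans _ _ (gamma * r)); first by rewrite ler_pM2l.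
by rewrite -ltr_pdivlMr// mul1r.
Qed.

(** For a = A^* y, |a|^2 = <A a, y> <= |A a| |y|; squaring and cancelling |a|^2 gives the bound. *)
Lemma adjoint_norm_sq (M : R) y : 0 <= M -> (forall x, `|A x| ^+ 2 <= M * `|x| ^+ 2) ->
  `|adjoint A y| ^+ 2 <= M * `|y| ^+ 2.
Proof.
move=> M0 hM; set a := adjoint A y.
have h : `|a| ^+ 2 <= `|A a| * `|y|.
  rewrite -inner_norm {2}/a -adjointE//.
  exact: le_trans (ler_norm _) (cauchy_schwarz _ _).
have [->|a0] := eqVneq a 0; first by rewrite normr0 expr0n mulr_ge0 ?sqr_ge0.
have na : 0 < `|a| ^+ 2 by rewrite exprn_gt0// normr_gt0.
rewrite -(ler_pM2l na); apply: (@le_trans _ _ ((`|A a| * `|y|) ^+ 2)).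
  by rewrite -expr2 ler_pXn2r// nnegrE ?mulr_ge0// ltW.
have := ler_wpM2r (sqr_ge0 `|y|) (hM a); rewrite exprMn; lra.
Qed.

End SpectralRadius.

(** * Weak limits along filters, demiclosedness and Opial's argument *)

Lemma cvg_unique_real {R : realType} {T : Type} (F : set_system T) (u : T -> R)
    (a b : R) : ProperFilter F ->
  u k @[k --> F] --> a -> u k @[k --> F] --> b -> a = b.
Proof. by move=> FP ua ub; exact: (@cvg_unique _ (@Rhausdorff R) (u @ F)). Qed.

Lemma cvg_le {R : realType} {T : Type} (F : set_system T) (u : T -> R)
    (a c : R) : ProperFilter F ->
  u k @[k --> F] --> a -> (forall k, u k <= c) -> a <= c.
Proof.
move=> FP ua uc; apply: (@closed_cvg _ _ F FP u [set r | r <= c] _ _ a ua).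
  exact: closed_le.
exact: nearW.
Qed.

Section WeakLimits.
Context {R : realType} {H : hilbertType R}.

Lemma bounded_weak_ultralimit {T : Type} (F : set_system T) (x : T -> H) (B : R) :
  UltraFilter F -> (forall k, `|x k| <= B) ->
  exists z, forall h, inner (x k) h @[k --> F] --> inner z h.
Proof.
move=> FU xB; have FP : ProperFilter F by exact: ultra_proper.
have bnd h k : `|inner (x k) h| <= B * `|h|.
  by apply: le_trans (cauchy_schwarz _ _) _; rewrite ler_wpM2r.
have /choice[phi phiP] : forall h, exists l : R, inner (x k) h @[k --> F] --> l.
  by move=> h; exact: ultrafilter_bounded_cvg (bnd h).
have [|h|z zP] := riesz_bounded phi B.
- move=> a u v; apply: (cvg_unique_real _ _ _ _ FP (phiP (a *: u + v))).
  have -> : (fun k => inner (x k) (a *: u + v)) =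
      (fun k => a * inner (x k) u + inner (x k) v).
    by apply/funext => k; rewrite innerDr innerZr.
  by apply: cvgD; [apply: cvgMl_tmp; exact: phiP|exact: phiP].
- exact: (cvg_le _ _ _ _ FP (cvg_norm (phiP h)) (bnd h)).
- by exists z => h; rewrite -zP.
Qed.

(** Put v = z - N z. Squaring |w_k - N z| <= d_k + |w_k - z| gives |v|^2 <= 2 <z - w_k, v> + d_k
    (d_k + 2 |w_k - z|), and the right side tends to 0. *)
Lemma demiclosed {T : Type} (F : set_system T) (N : H -> H) (w : T -> H) z (B : R) :
  ProperFilter F -> (forall x y, `|N x - N y| <= `|x - y|) ->
  (forall k, `|w k| <= B) ->
  (forall h, inner (w k) h @[k --> F] --> inner z h) ->
  `|N (w k) - w k| @[k --> F] --> (0 : R) ->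
  N z = z.
Proof.
move=> FP Nn wB wz Nw.
pose d k := `|N (w k) - w k|; pose v := z - N z.
apply/eqP; rewrite eq_sym -subr_eq0 -/v; apply/eqP/inner_eq0/eqP.
rewrite eq_le inner_ge0 andbT.
(* [B + |z|] replaces |w_k - z|, which need not converge; [gap] is never positive, yet tends to
   |v|^2. *)
pose gap k := inner v v - (2 * (inner z v - inner (w k) v) + d k * (d k + 2 * (B + `|z|))).
have gapv : gap k @[k --> F] -->
    inner v v - (2 * (inner z v - inner z v) + 0 * (0 + 2 * (B + `|z|))).
  apply: cvgB; first exact: cvg_cst.
  apply: cvgD; first by apply: cvgMl_tmp; apply: cvgB => //; exact: cvg_cst.
  by apply: cvgM => //; apply: cvgD => //; exact: cvg_cst.
move: gapv; rewrite subrr mulr0 mul0r addr0 subr0 => gapv.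
apply: (cvg_le _ _ _ _ FP gapv) => k; rewrite /gap subr_le0.
have tri : `|w k - N z| <= d k + `|w k - z|.
  rewrite /d -(normrN (N _ - _)) opprB.
  by apply: le_trans (ler_distD (N (w k)) _ _) _; rewrite lerD2l.
have d0 : 0 <= d k by exact: normr_ge0.
have e0 : 0 <= `|w k - z| by exact: normr_ge0.
have eB : `|w k - z| <= B + `|z|.
  by apply: le_trans (ler_normB _ _) _; rewrite lerD2r.
have sq : `|w k - N z| ^+ 2 <= (d k + `|w k - z|) ^+ 2.
  by rewrite ler_pXn2r// nnegrE ?addr_ge0.
have : inner v v <= 2 * (inner z v - inner (w k) v) + d k * (d k + 2 * `|w k - z|).
  have e2 : `|w k - N z| ^+ 2 = `|w k - z| ^+ 2 + 2 * inner (w k - z) v + inner v v.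
    by rewrite inner_norm -normD_sq /v addrA subrK.
  move: sq; rewrite e2 innerDl innerNl; lra.
move/le_trans; apply; rewrite lerD2l ler_wpM2l// lerD2l; lra.
Qed.

Lemma fejer_gap_cvg0 (a b : nat -> R) : (forall k, 0 <= a k) ->
  (forall k, 0 <= b k) -> (forall k, a k.+1 <= a k - b k) ->
  cvgn a /\ b k @[k --> \oo] --> (0 : R).
Proof.
move=> a0 b0 ab.
have ca : cvgn a.
  apply: nonincreasing_is_cvgn.
    apply/nonincreasing_seqP => n; apply: le_trans (ab n) _.
    by rewrite gerBl.
  by exists 0 => _ [k _ <-].
split=> //.
have gap : a k - a k.+1 @[k --> \oo] --> (0 : R).
  rewrite -(subrr (lim (a @ \oo))); apply: cvgB => //.
  by rewrite (cvg_shiftS a).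
apply: (squeeze_cvgr _ (cvg_cst 0) gap); apply: nearW => k.
by rewrite b0 /= lerBrDl addrC -lerBrDl; apply: le_trans (ab k) _; rewrite lerD2l.
Qed.

(* Opial: along two ultrafilters, the limit of [|x_k - z1|^2 - |x_k - z2|^2]
   determines the weak limits [z1] and [z2] up to equality. *)
Lemma opial (G : set H) (x : nat -> H) (B : R) :
  (forall k, `|x k| <= B) ->
  (forall z, G z -> cvgn (fun k => `|x k - z| ^+ 2)) ->
  (forall (F : set_system nat) z, UltraFilter F -> \oo `<=` F ->
    (forall h, inner (x k) h @[k --> F] --> inner z h) -> G z) ->
  exists z, G z /\ forall h, inner (x k) h @[k --> \oo] --> inner z h.
Proof.
move=> xB xG GF.
have uniq F1 F2 z1 z2 : UltraFilter F1 -> UltraFilter F2 ->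
    \oo `<=` F1 -> \oo `<=` F2 ->
    (forall h, inner (x k) h @[k --> F1] --> inner z1 h) ->
    (forall h, inner (x k) h @[k --> F2] --> inner z2 h) -> z1 = z2.
  move=> U1 U2 s1 s2 w1 w2.
  have P1 : ProperFilter F1 by exact: ultra_proper.
  have P2 : ProperFilter F2 by exact: ultra_proper.
  have c1 := xG z1 (GF _ _ U1 s1 w1); have c2 := xG z2 (GF _ _ U2 s2 w2).
  have [l cl] : exists l : R, inner (x k) (z1 - z2) @[k --> \oo] --> l.
    exists ((`|z1| ^+ 2 - `|z2| ^+ 2 -
      (lim ((fun k => `|x k - z1| ^+ 2) @ \oo) -
       lim ((fun k => `|x k - z2| ^+ 2) @ \oo))) / 2).
    have -> : (fun k => inner (x k) (z1 - z2)) = (fun k =>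
        (`|z1| ^+ 2 - `|z2| ^+ 2 - (`|x k - z1| ^+ 2 - `|x k - z2| ^+ 2)) / 2).
      by apply/funext => k; rewrite !(normB_sq (x k)) innerDr innerNr; field.
    by apply: cvgMr_tmp; apply: cvgB; [exact: cvg_cst|exact: cvgB].
  have l1 : inner z1 (z1 - z2) = l.
    by apply: (cvg_unique_real _ _ _ _ P1 (w1 _)) => S /cl; exact: s1.
  have l2 : inner z2 (z1 - z2) = l.
    by apply: (cvg_unique_real _ _ _ _ P2 (w2 _)) => S /cl; exact: s2.
  apply/eqP; rewrite -subr_eq0; apply/eqP/inner_eq0.
  by rewrite innerDl innerNl l1 l2 subrr.
have [F [FU sF]] := ultraFilterLemma eventually_filter.
have [z wz] := bounded_weak_ultralimit F x B FU xB.
exists z; split; first exact: GF wz.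
move=> h S Sz; apply: contrapT => nS.
(* If convergence along [\oo] failed, [\oo] restricted to the bad indices [E] would be proper. An
   ultrafilter refining it has the same weak limit z by uniqueness, so it contains both [E] and its
   complement. *)
pose E := ~` [set k | S (inner (x k) h)].
have EP : ProperFilter (within E \oo).
  apply: Build_ProperFilter => nE; apply: nS.
  change (\forall k \near \oo, S (inner (x k) h)).
  apply: (filterS _ (nE : \forall k \near \oo, E k -> set0 k)) => k nEk.
  by apply: contrapT => /nEk.
have [F' [FU' sF']] := ultraFilterLemma EP.
have sF2 : \oo `<=` F'.
  by move=> S' S'oo; apply: sF'; apply: filterS S'oo => k.
have [z' wz'] := bounded_weak_ultralimit F' x B FU' xB.
have zz' : z = z' by exact: (uniq F F').
have P' : ProperFilter F' by exact: ultra_proper.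
have F'E : F' E by apply: sF'; apply: nearW => k.
have F'S : F' [set k | S (inner (x k) h)].
  by have := wz' h S; rewrite -zz' => /(_ Sz).
by have [k []] := filter_ex (filterI F'E F'S).
Qed.

End WeakLimits.

(** * The iteration for nonexpansive U and T *)

Section SplitFixedPoints.
Context {R : realType} {H1 H2 : hilbertType R}.
Variables (A : {linear H1 -> H2}).
Hypothesis A_bounded : bounded_linear A.

Lemma cvg_sqr0 (u : nat -> R) : (forall k, 0 <= u k) ->
  u k ^+ 2 @[k --> \oo] --> (0 : R) -> u k @[k --> \oo] --> (0 : R).
Proof.
move=> u0 u2; rewrite -(@sqrtr0 R).
have -> : u = (fun k => Num.sqrt (u k ^+ 2)).
  by apply/funext => k; rewrite sqrtr_sqr ger0_norm.
by apply: continuous_cvg => //; exact: sqrt_continuous.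
Qed.

(** Expanding the square leaves the cross term 2 gamma <Ax - Az, r> <= - gamma |r|^2 and the term
    gamma^2 |A^* r|^2 <= gamma^2 M |r|^2. *)
Lemma landweber_step (T : H2 -> H2) (gamma M : R) x z :
  0 < gamma -> 0 <= M -> (forall x, `|A x| ^+ 2 <= M * `|x| ^+ 2) ->
  (forall x y, `|T x - T y| <= `|x - y|) -> T (A z) = A z ->
  `|x + gamma *: adjoint A (T (A x) - A x) - z| ^+ 2 <=
    `|x - z| ^+ 2 - gamma * (1 - gamma * M) * `|T (A x) - A x| ^+ 2.
Proof.
move=> g0 M0 hM Tn Tz; set r := T (A x) - A x.
have hr : 2 * inner (A x - A z) r <= - `|r| ^+ 2.
  exact: nonexpansive_fixed_inner.
have ha := adjoint_norm_sq A A_bounded M r M0 hM.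
rewrite addrAC normD_sq innerZr -adjointE// (linearB A).
rewrite -[`|gamma *: _| ^+ 2]inner_norm innerZl innerZr inner_norm.
have h1 := ler_wpM2l (ltW g0) hr.
have h2 := ler_wpM2l (ltW g0) (ler_wpM2l (ltW g0) ha).
move: (inner _ r) (`|r| ^+ 2) (`|adjoint A r| ^+ 2) (`|x - z| ^+ 2) h1 h2.
move=> s n a d h1 h2; lra.
Qed.

Lemma split_fixed_points_weak_cvg (U : H1 -> H1) (T : H2 -> H2) (gamma M : R)
    (G := [set z | U z = z /\ T (A z) = A z]) (x : nat -> H1) :
  0 < gamma -> 0 <= M -> gamma * M < 1 ->
  (forall x, `|A x| ^+ 2 <= M * `|x| ^+ 2) ->
  (forall x y, `|U x - U y| <= `|x - y|) ->
  (forall x y, `|T x - T y| <= `|x - y|) ->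
  (forall z, G z -> forall y,
    `|U y - z| ^+ 2 <= `|y - z| ^+ 2 - `|U y - y| ^+ 2) ->
  G !=set0 ->
  (forall k, x k.+1 = U (x k + gamma *: adjoint A (T (A (x k)) - A (x k)))) ->
  exists z, G z /\ forall h, inner (x k) h @[k --> \oo] --> inner z h.
Proof.
move=> g0 M0 gM hM Un Tn cut [z0 Gz0] xS.
pose r k := T (A (x k)) - A (x k).
pose w k := x k + gamma *: adjoint A (r k).
pose c := gamma * (1 - gamma * M).
have c0 : 0 < c by rewrite mulr_gt0// subr_gt0.
(* The guaranteed decrease of |x_k - z|^2 in one iteration, the same for every z in [G]. *)
pose b k := c * `|r k| ^+ 2 + `|U (w k) - w k| ^+ 2.
have step z k : G z -> `|w k - z| ^+ 2 <= `|x k - z| ^+ 2 - c * `|r k| ^+ 2.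
  by case=> _ Tz; exact: landweber_step.
have fejer z : G z -> cvgn (fun k => `|x k - z| ^+ 2) /\ b k @[k --> \oo] --> (0 : R).
  move=> Gz; apply: fejer_gap_cvg0 => k; first exact: sqr_ge0.
    by rewrite addr_ge0 ?sqr_ge0// mulr_ge0 ?sqr_ge0// ltW.
  have := cut z Gz (w k); have := step z k Gz; rewrite xS -/(r k) -/(w k) /b; lra.
have [_ b_cvg0] := fejer z0 Gz0.
have r_cvg0 : `|r k| @[k --> \oo] --> (0 : R).
  apply: cvg_sqr0 => //.
  have cb : c^-1 * b k @[k --> \oo] --> (0 : R) by rewrite -(mulr0 c^-1); exact: cvgMl_tmp.
  apply: (squeeze_cvgr _ (cvg_cst 0) cb); apply: nearW => k.
  by rewrite sqr_ge0 /= ler_pdivlMl// /b lerDl sqr_ge0.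
have Uw_cvg0 : `|U (w k) - w k| @[k --> \oo] --> (0 : R).
  apply: cvg_sqr0 => //; apply: (squeeze_cvgr _ (cvg_cst 0) b_cvg0); apply: nearW => k.
  by rewrite sqr_ge0 /b lerDr mulr_ge0 ?sqr_ge0// ltW.
have wx k : `|w k - z0| <= `|x k - z0|.
  rewrite -(@ler_pXn2r _ 2)// ?nnegrE//; apply: le_trans (step _ k Gz0) _.
  by rewrite gerBl mulr_ge0 ?sqr_ge0// ltW.
have xz0 k : `|x k - z0| <= `|x 0%N - z0|.
  elim: k => // k IH; apply: le_trans IH; apply: le_trans (wx k).
  rewrite xS -/(r k) -/(w k) -{1}(Gz0.1); exact: Un.
pose B := `|x 0%N - z0| + `|z0|.
have xB k : `|x k| <= B.
  by rewrite -(subrK z0 (x k)); apply: le_trans (ler_normD _ _) _; rewrite lerD2r.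
have wB k : `|w k| <= B.
  rewrite -(subrK z0 (w k)); apply: le_trans (ler_normD _ _) _; rewrite lerD2r.
  exact: le_trans (wx k) (xz0 k).
apply: (opial G x B) => // [z /fejer[]//|F z FU sF xz].
have FP : ProperFilter F by exact: ultra_proper.
split.
(* U almost fixes w_k rather than x_k; the two share their weak limit because w_k - x_k = gamma A^*
   r_k tends weakly to 0. *)
- apply: (demiclosed F U w z B) => //; last by move=> S /Uw_cvg0; exact: sF.
  move=> h.
  have rA : inner (r k) (A h) @[k --> \oo] --> (0 : R).
    apply/norm_cvg0P.
    have rAb : `|r k| * `|A h| @[k --> \oo] --> (0 : R).
      by rewrite -(mul0r `|A h|); exact: cvgMr_tmp.
    apply: (squeeze_cvgr _ (cvg_cst 0) rAb); apply: nearW => k.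
    by rewrite normr_ge0 cauchy_schwarz.
  have -> : (fun k => inner (w k) h) =
      (fun k => inner (x k) h + gamma * inner (r k) (A h)).
    apply/funext => k; rewrite innerDl innerZl (innerC (adjoint _ _)).
    by rewrite -adjointE// (innerC (A h)).
  rewrite -[inner z h]addr0 -[in X in _ --> _ + X](mulr0 gamma).
  apply: cvgD => //; apply: cvgMl_tmp => S /rA; exact: sF.
- have [K hK] := A_bounded.
  (* Moving A to the test vector by its adjoint shows that A x_k tends weakly to A z along [F]. *)
  apply: (demiclosed F T (A \o x) (A z) (`|K| * B)) => //.
  + move=> k; apply: le_trans (hK _) _.
    apply: le_trans (ler_wpM2r (normr_ge0 _) (ler_norm K)) _.
    by rewrite ler_wpM2l.
  + move=> h; rewrite adjointE//.
    have -> : (fun k => inner ((A \o x) k) h) = (fun k => inner (x k) (adjoint A h)).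
      by apply/funext => k; rewrite /= adjointE.
    exact: xz.
  + by move=> S /r_cvg0; exact: sF.
Qed.

End SplitFixedPoints.

Theorem theorem6p3 (R : realType) (H1 H2 : hilbertType R)
    (A : {linear H1 -> H2}) (A_bounded : bounded_linear A)
    (C : set H1) (C_neq0 : C !=set0) (C_closed : closed C)
    (C_convex : convex_set C)
    (Q : set H2) (Q_neq0 : Q !=set0) (Q_closed : closed Q)
    (Q_convex : convex_set Q)
    (f : H1 -> H1) (g : H2 -> H2) (alpha1 alpha2 : R)
    (f_ISM : ISM alpha1 setT f) (g_ISM : ISM alpha2 setT g)
    (gamma lambda : R) :
  let alpha := Num.min alpha1 alpha2 in
  let L := spectral_radius (adjoint A \o A) in
  let U := proj_grad C lambda f in
  let T := proj_grad Q lambda g in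
  let Gamma := [set z | SOL C f z /\ SOL Q g (A z)] in
  0 < gamma -> (gamma%:E < L^-1)%E ->
  0 < lambda <= 2 * alpha ->
  Gamma !=set0 ->
  (forall xstar, SOL C f xstar ->
    forall x, 0 <= inner (f x) (proj_grad C lambda f x - xstar)) ->
  forall x : nat -> H1,
    (forall k, x k.+1 = U (x k + gamma *: adjoint A (T (A (x k)) - A (x k)))) ->
  exists xstar : H1, Gamma xstar /\ weakly_converges x xstar.
Proof.
move=> alpha L U T Gamma g0 gL /andP[l0 la] [z0 Gz0] cutter x xS.
have [M [M0 gM hM]] := norm_sq_spectral_radius A A_bounded gamma g0 gL.
have GammaE z : Gamma z <-> U z = z /\ T (A z) = A z.
  by rewrite /Gamma /= !(SOL_fixed _ _ lambda).
have lalpha1 : 0 <= lambda <= 2 * alpha1.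
  by rewrite ltW//= (le_trans la)// ler_pM2l// ge_min lexx.
have lalpha2 : 0 <= lambda <= 2 * alpha2.
  by rewrite ltW//= (le_trans la)// ler_pM2l// ge_min lexx orbT.
have [] := split_fixed_points_weak_cvg A A_bounded U T gamma M x g0 M0 gM hM _ _ _ _ xS.
- by move=> y z; exact: proj_grad_nonexpansive f_ISM lalpha1.
- by move=> y z; exact: proj_grad_nonexpansive g_ISM lalpha2.
- move=> z /GammaE[Cz _] y; apply: proj_grad_cutter => //.
  + exact: ltW.
  + by case: Cz.
  + exact: cutter.
- by exists z0; apply/GammaE.
- move=> z [/GammaE Gz xz]; exists z; split=> // phi cphi.
  (* Riesz turns each continuous functional into an inner product, the form in which weak
     convergence was obtained. *)
  have [h hE] := riesz phi cphi.
  rewrite hE innerC; under eq_fun do rewrite hE innerC.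
  exact: xz.
Qed.
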